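(* Let $\mathcal{A}\in \mathbb{C}^{I_1\times\cdots\times I_M\times J_1 \times \cdots \times J_N }$ with $\mathrm{rshrank}(\mathcal{A}) = r$. Then $\mathcal{A}$ has a singular value decomposition of the form $$\mathcal{A} = \mathcal{U}*_M \mathcal{D}*_N\mathcal{V}^*,$$ where $\mathcal{U} \in \mathbb{C}^{I_1 \times \cdots \times I_M \times I_1 \times \cdots \times I_M}$ and $\mathcal{V} \in \mathbb{C}^{J_1 \times \cdots \times J_N \times J_1 \times \cdots \times J_N}$ are unitary tensors, and $\mathcal{D} \in \mathbb{C}^{I_1 \times \cdots \times I_M \times J_1 \times \cdots \times J_N }$ is a diagonal tensor with entries $$(\mathcal{D})_{i_1 \cdots i_M j_1 \cdots j_N} = \begin{cases}\sigma_{I} >0, & \text{if } I = J \in \{1,2,\ldots,r\},\\ 0, & \text{otherwise,}\end{cases}$$ where $I = i_1+\sum_{k=2}^{M} (i_k - 1) \prod_{l=1}^{k-1} I_l$ and $J = j_1+\sum_{k=2}^{N} (j_k-1) \prod_{l=1}^{k-1} J_l$.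
   Context: Einstein product: for $\mathcal{A}\in\mathbb{C}^{I_1\times\cdots\times I_M\times J_1\times\cdots\times J_N}$ and $\mathcal{B}\in\mathbb{C}^{J_1\times\cdots\times J_N\times K_1\times\cdots\times K_L}$, $(\mathcal{A}*_N\mathcal{B})_{i_1\ldots i_Mk_1\ldots k_L}=\sum_{j_1,\ldots,j_N}a_{i_1\ldots i_Mj_1\ldots j_N}b_{j_1\ldots j_Nk_1\ldots k_L}$ (the subscript is the number of contracted indices). The conjugate transpose $\mathcal{A}^*\in\mathbb{C}^{J_1\times\cdots\times J_N\times I_1\times\cdots\times I_M}$ has entries $(\mathcal{A}^* )_{j_1\ldots j_Ni_1\ldots i_M}=\overline{a_{i_1\ldots i_Mj_1\ldots j_N}}$. The identity tensor in $\mathbb{C}^{J_1\times\cdots\times J_N\times J_1\times\cdots\times J_N}$ has entries $\prod_{k=1}^N\delta_{i_kj_k}$. A tensor $\mathcal{U}\in\mathbb{C}^{I_1\times\cdots\times I_M\times I_1\times\cdots\times I_M}$ is unitary if $\mathcal{U}*_M\mathcal{U}^*=\mathcal{U}^**_M\mathcal{U}$ is the identity tensor. A tensor $\mathcal{D}\in\mathbb{C}^{I_1\times\cdots\times I_M\times J_1\times\cdots\times J_N}$ is diagonal if $d_{i_1\ldots i_Mj_1\ldots j_N}=0$ whenever $i_1+\sum_{k=2}^{M}(i_k-1)\prod_{l=1}^{k-1}I_l\neq j_1+\sum_{k=2}^{N}(j_k-1)\prod_{l=1}^{k-1}J_l$. The reshape map $\mathrm{rsh}:\mathbb{C}^{I_1\times\cdots\times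 I_M\times J_1\times\cdots\times J_N}\to\mathbb{C}^{(I_1\cdots I_M)\times(J_1\cdots J_N)}$ sends $\mathcal{A}$ to the matrix whose entry in row $i_1+\sum_{k=2}^{M}(i_k-1)\prod_{l=1}^{k-1}I_l$ and column $j_1+\sum_{k=2}^{N}(j_k-1)\prod_{l=1}^{k-1}J_l$ is $a_{i_1\ldots i_Mj_1\ldots j_N}$, and $\mathrm{rshrank}(\mathcal{A})$ is the rank of the matrix $\mathrm{rsh}(\mathcal{A})$. *)

(* Defs.v *)
From HB Require Import structures.
From mathcomp Require Import all_boot all_order all_algebra.
From mathcomp Require Import complex reals.

Set Implicit Arguments.
Unset Strict Implicit.
Unset Printing Implicit Defensive.

Import Order.TTheory GRing.Theory Num.Theory.
Local Open Scope ring_scope.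

(* All indices are 0-based: an index i_k in {1, .., I_k} is represented by
   the ordinal i_k - 1 : 'I_(I k). *)
Notation mindex I := {dffun forall k, 'I_(I k)}.

Definition stride M (I : 'I_M -> nat) (m : nat) : nat :=
  (\prod_(l < M | l < m) I l)%N.

(* With 1-based indices this is i_1 + \sum_(k >= 2) (i_k - 1) \prod_(l < k) I_l,
   shifted down by 1. *)
Definition lindex M (I : 'I_M -> nat) (i : mindex I) : nat :=
  (\sum_(k < M) i k * stride I k)%N.

Lemma strideS M (I : 'I_M -> nat) (k : 'I_M) :
  stride I k.+1 = (stride I k * I k)%N.
Proof.
rewrite /stride (bigD1 k) //= mulnC; congr (_ * _)%N.
by apply: eq_bigl => l; rewrite ltnS [RHS]ltn_neqAle andbC.
Qed.

Lemma stride_full M (I : 'I_M -> nat) : stride I M = (\prod_k I k)%N.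
Proof. by apply: eq_bigl => l; rewrite ltn_ord. Qed.

Lemma lindex_ltn M (I : 'I_M -> nat) (i : mindex I) :
  (lindex i < \prod_k I k)%N.
Proof.
rewrite -stride_full.
suff H m : (m <= M)%N ->
    (\sum_(k < M | (k < m)%N) i k * stride I k < stride I m)%N.
  have := H M (leqnn M); congr (_ < _)%N.
  by apply: eq_bigl => k; rewrite ltn_ord.
elim: m => [_|m IHm ltmM]; first by rewrite big1 // /stride big1.
pose k := Ordinal ltmM.
rewrite (bigD1 k) //= (strideS I k) /=.
rewrite (eq_bigl (fun l : 'I_M => (l < m)%N)); last first.
  by move=> l; rewrite ltnS [RHS]ltn_neqAle andbC.
apply: (@leq_trans ((i k).+1 * stride I m)); last first.
  by rewrite mulnC leq_mul2l ltn_ord orbT.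
by rewrite mulSn addnC ltn_add2r IHm // ltnW.
Qed.

Definition lin M (I : 'I_M -> nat) (i : mindex I) : 'I_(\prod_k I k) :=
  Ordinal (lindex_ltn i).

Lemma dim_gt0 M (I : 'I_M -> nat) (p : 'I_(\prod_k I k)) (k : 'I_M) :
  (0 < I k)%N.
Proof.
have := leq_ltn_trans (leq0n p) (ltn_ord p).
by rewrite (bigD1 k) //= muln_gt0 => /andP[].
Qed.

(* The inverse of lin (lemmas unlinK and linK), by mixed-radix digits. *)
Definition unlin M (I : 'I_M -> nat) (p : 'I_(\prod_k I k)) : mindex I :=
  [ffun k : 'I_M => Ordinal (ltn_pmod (p %/ stride I k) (dim_gt0 p k))].

Lemma unlinK M (I : 'I_M -> nat) : cancel (@unlin M I) (@lin M I).
Proof.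
move=> p; apply: val_inj => /=.
suff H m : (m <= M)%N ->
    (\sum_(k < M | (k < m)%N) unlin p k * stride I k = p %% stride I m)%N.
  have := H M (leqnn M).
  rewrite stride_full modn_small ?ltn_ord // => <-.
  by apply: eq_bigl => k; rewrite ltn_ord.
elim: m => [_|m IHm ltmM].
  by rewrite [LHS]big1 // (_ : stride I 0 = 1%N) ?modn1 // /stride big1.
pose k := Ordinal ltmM.
rewrite (bigD1 k) //= (strideS I k) /=.
rewrite (eq_bigl (fun l : 'I_M => (l < m)%N)); last first.
  by move=> l; rewrite ltnS [RHS]ltn_neqAle andbC.
rewrite IHm 1?ltnW // ffunE /= modn_divl [(I k * _)%N]mulnC.
rewrite [RHS](divn_eq _ (stride I m)); congr (_ + _)%N.
by rewrite modn_dvdm ?dvdn_mulr.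
Qed.

Lemma linK M (I : 'I_M -> nat) : cancel (@lin M I) (@unlin M I).
Proof.
have unlin_bij : bijective (@unlin M I).
  apply: inj_card_bij (can_inj (@unlinK M I)) _.
  rewrite card_ord card_dep_ffun foldrE big_map big_enum /=.
  by under eq_bigr do rewrite card_ord.
exact/(bij_can_sym unlin_bij)/unlinK.
Qed.

Definition tensor (C : Type) M N (I : 'I_M -> nat) (J : 'I_N -> nat) : Type :=
  {ffun mindex I * mindex J -> C}.

Section Tensors.
Variable C : numClosedFieldType.

Definition einstein M N L (I : 'I_M -> nat) (J : 'I_N -> nat) (K : 'I_L -> nat)
    (A : tensor C I J) (B : tensor C J K) : tensor C I K :=
  [ffun ik => \sum_(j : mindex J) A (ik.1, j) * B (j, ik.2)].

Definition conjtr M N (I : 'I_M -> nat) (J : 'I_N -> nat)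
    (A : tensor C I J) : tensor C J I :=
  [ffun ji => (A (ji.2, ji.1))^*].

Definition idtensor N (J : 'I_N -> nat) : tensor C J J :=
  [ffun ij : mindex J * mindex J => \prod_(k < N) (ij.1 k == ij.2 k)%:R].

Definition unitary_tensor M (I : 'I_M -> nat) (U : tensor C I I) : Prop :=
  einstein U (conjtr U) = idtensor I /\ einstein (conjtr U) U = idtensor I.

Definition diagonal_tensor M N (I : 'I_M -> nat) (J : 'I_N -> nat)
    (D : tensor C I J) : Prop :=
  forall i j, lindex i <> lindex j -> D (i, j) = 0.

Definition rsh M N (I : 'I_M -> nat) (J : 'I_N -> nat) (A : tensor C I J) :
    'M[C]_(\prod_k I k, \prod_k J k) :=
  \matrix_(p, q) A (unlin p, unlin q).

Lemma rshE M N (I : 'I_M -> nat) (J : 'I_N -> nat) (A : tensor C I J) i j :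
  rsh A (lin i) (lin j) = A (i, j).
Proof. by rewrite mxE !linK. Qed.

Definition rshrank M N (I : 'I_M -> nat) (J : 'I_N -> nat)
    (A : tensor C I J) : nat := \rank (rsh A).

End Tensors.

(* Main.v *)
(** Write A = W V with V an orthonormal basis of the row space of A, and
    diagonalise the Gram matrix of W^*.  The eigenvectors turn the rows of W^*
    into pairwise orthogonal nonzero rows, whose norms are the singular values;
    normalising gives A = P^* diag(s) Q with P and Q having orthonormal rows,
    and completing P and Q to unitary matrices gives the full decomposition.
    The bijection lin carries the matrix decomposition back to tensors. *)
Require Import Defs.
From mathcomp Require Import all_boot all_order all_algebra.
From mathcomp Require Import complex reals.

Set Implicit Arguments.
Unset Strict Implicit.
Unset Printing Implicit Defensive.

Import Order.TTheory GRing.Theory Num.Theory.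
Local Open Scope ring_scope.
Local Open Scope complex_scope.

Section MatrixSVD.
Variable C : numClosedFieldType.
Local Open Scope sesquilinear_scope.

Lemma trmxC_mul m n p (A : 'M[C]_(m, n)) (B : 'M[C]_(n, p)) :
  (A *m B)^t* = B^t* *m A^t*.
Proof. by rewrite trmx_mul map_mxM. Qed.

Lemma mxrank_trmxC m n (A : 'M[C]_(m, n)) : \rank (A^t*) = \rank A.
Proof. by rewrite mxrank_map mxrank_tr. Qed.

Lemma gram_hermitian m n (A : 'M[C]_(m, n)) : A *m A^t* \is hermsymmx.
Proof.
apply/is_hermitianmxP; rewrite expr0 scale1r.
by rewrite trmxC_mul trmxCK.
Qed.

(** The missing rows form an orthonormal basis [W] of the kernel of [V^t*], the orthogonal
    complement of the row space of [V]; rank-nullity gives their number. *)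
Lemma unitarymx_complete m n (V : 'M[C]_(m, n)) : V \is unitarymx ->
  exists2 P : 'M[C]_n, P \is unitarymx & pid_mx m *m P = V.
Proof.
move=> Vu; pose K := kermx (V^t*); pose W := schmidt (row_base K).
have Wu : W \is unitarymx by rewrite schmidt_unitarymx ?rank_leq_col.
have WV0 : W *m V^t* = 0.
  by apply/sub_kermxP; rewrite eqmx_schmidt_free ?row_base_free ?eq_row_base.
have VW0 : V *m W^t* = 0.
  by rewrite -[V]trmxCK -trmxC_mul WV0 trmx0 map_mx0.
have Xu : col_mx V W \is unitarymx.
  apply/unitarymxP; rewrite tr_col_mx map_row_mx mul_col_row WV0 VW0.
  by rewrite !(unitarymxP _) // -scalar_mx_block.
have en : (m + \rank K = n)%N.
  rewrite mxrank_ker mxrank_trmxC (mxrank_unitary Vu) subnKC //.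
  by rewrite -(mxrank_unitary Vu) rank_leq_col.
(* The stacked matrix has size [m + \rank K], only provably equal to [n]; generalising [\rank K]
   allows [n] to be substituted away. *)
clear Wu WV0 VW0; clearbody W; move: (\rank K) en W Xu => k en {K}.
case: _ / en V {Vu} => V W Xu; exists (col_mx V W) => //.
by rewrite pid_mx_row mul_row_col mul1mx mul0mx addr0.
Qed.

Lemma thin_svd m n (A : 'M[C]_(m, n)) :
  exists (P : 'M[C]_(\rank A, m)) (Q : 'M[C]_(\rank A, n)) (s : 'rV[C]_(\rank A)),
    [/\ P \is unitarymx, Q \is unitarymx, forall k, 0 < s 0 k
      & A = P^t* *m diag_mx s *m Q].
Proof.
set r := \rank A; pose V := schmidt (row_base A).
have Vu : V \is unitarymx by rewrite schmidt_unitarymx ?rank_leq_col.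
have /submxP[W defA] : (A <= V)%MS.
  by rewrite eqmx_schmidt_free ?row_base_free ?eq_row_base.
(* [W] has only [r] columns, and its product with [V] has rank [r]. *)
have rkW : \rank W = r.
  apply/eqP; rewrite eqn_leq rank_leq_col /=.
  by have := mxrankM_maxl W V; rewrite -defA.
pose G := W^t* *m W; pose S := spectralmx G; pose d := spectral_diag G.
have Su : S \is unitarymx by exact: spectral_unitarymx.
have SSt := unitarymxP Su; have StS := mulmx1C SSt.
have defG : G = S^t* *m diag_mx d *m S.
  rewrite -(invmx_unitary Su); apply/orthomx_spectralP/hermitian_normalmx.
  by rewrite /G -{2}[W]trmxCK gram_hermitian.
pose Y := S *m W^t*.
have YY : Y *m Y^t* = diag_mx d.
  rewrite trmxC_mul trmxCK mulmxA -[S *m _ *m W]mulmxA -/G defG.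
  by rewrite !mulmxA SSt mul1mx -mulmxA SSt mulmx1.
have Yfree : row_free Y.
  by rewrite /row_free eqmxMfull ?mxrank_trmxC ?rkW // row_full_unit unitarymx_unit.
(* By [YY], [d 0 k] is the squared norm of row [k] of [Y]; a zero row would contradict the right
   inverse of [Y]. *)
have d_gt0 k : 0 < d 0 k.
  have -> : d 0 k = (row k Y *m (row k Y)^t*) 0 0.
    rewrite -map_trmx -row_mul.
    have /matrixP/(_ k k) := YY; rewrite !mxE eqxx mulr1n => <-.
    by apply: eq_bigr => j _; rewrite !mxE.
  rewrite -dotmxE dnorm_gt0; apply: contraTneq Yfree => rowY0.
  apply/negP => /row_freeP[Z YZ]; have /matrixP/(_ k k) := YZ.
  have : row k (Y *m Z) = 0 by rewrite row_mul rowY0 mul0mx.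
  by move=> /rowP/(_ k); rewrite !mxE eqxx => -> /eqP; rewrite eq_sym oner_eq0.
pose s : 'rV[C]_r := \row_k sqrtC (d 0 k).
have s_gt0 k : 0 < s 0 k by rewrite mxE sqrtC_gt0.
pose t : 'rV[C]_r := \row_k (s 0 k)^-1.
have ts : diag_mx t *m diag_mx s = 1%:M.
  rewrite mulmx_diag -diag_const_mx; congr diag_mx; apply/rowP => k.
  by rewrite !mxE mulVf // sqrtC_eq0 gt_eqF.
have ss : diag_mx s *m diag_mx s = diag_mx d.
  by rewrite mulmx_diag; congr diag_mx; apply/rowP => k; rewrite !mxE -expr2 sqrtCK.
have tt : (diag_mx t)^t* = diag_mx t.
  rewrite tr_diag_mx map_diag_mx; congr diag_mx; apply/rowP => k.
  rewrite mxE; apply/CrealP; rewrite mxE realV; exact: gtr0_real.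
(* As [t] inverts [s] and [Y^t* = W *m S^t*], the product collapses to
   [W *m S^t* *m S *m V = W *m V]. *)
exists (diag_mx t *m Y), (S *m V), s; split=> //.
- apply/unitarymxP; rewrite trmxC_mul tt mulmxA -[_ *m Y *m _]mulmxA YY -ss.
  by rewrite mulmxA ts mul1mx; apply: mulmx1C.
- exact: mul_unitarymx.
- rewrite trmxC_mul tt -[_ *m _ *m diag_mx s]mulmxA ts mulmx1 trmxC_mul trmxCK.
  by rewrite -mulmxA [S^t* *m _]mulmxA StS mul1mx.
Qed.

(** The middle factor is [diag_mx s] padded with zeros to size [m] by [n]: each [pid_mx] selects the
    first [\rank A] rows of a completed unitary matrix, one of them transposed. *)
Lemma svd m n (A : 'M[C]_(m, n)) :
  exists (P : 'M[C]_m) (Q : 'M[C]_n) (s : 'rV[C]_(\rank A)),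
    [/\ P \is unitarymx, Q \is unitarymx, forall k, 0 < s 0 k
      & A = P *m (pid_mx (\rank A) *m diag_mx s *m pid_mx (\rank A)) *m Q^t*].
Proof.
have [P [Q [s [Pu Qu s_gt0 defA]]]] := thin_svd A.
have [P1 P1u defP] := unitarymx_complete Pu.
have [Q1 Q1u defQ] := unitarymx_complete Qu.
exists (P1^t*), (Q1^t*), s; split; rewrite ?trmxC_unitary // trmxCK.
by rewrite {1}defA -defP -defQ trmxC_mul tr_pid_mx map_pid_mx !mulmxA.
Qed.

Lemma pid_diag_pidE m n r (s : 'rV[C]_r) (p : 'I_m) (q : 'I_n) :
  (pid_mx r *m diag_mx s *m pid_mx r) p q =
    if p == q :> nat then oapp (s 0) 0 (insub (p : nat)) else 0.
Proof.
rewrite mul_mx_diag mxE; case: insubP => [k ltpr valk | nltpr] /=; last first.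
  rewrite big1 ?if_same // => k _; rewrite !mxE (negPf nltpr) andbF.
  by rewrite !mul0r.
(* Only the term whose index has value [p] survives in the matrix product. *)
rewrite (bigD1 k) //= big1 => [|l nelk]; last first.
  rewrite !mxE -valk [k == l :> nat]eq_sym.
  by rewrite [(l == k :> nat)](negPf nelk) !mul0r.
rewrite !mxE -valk eqxx ltn_ord addr0 mul1r andbT.
by case: eqP => _; rewrite ?mulr1 ?mulr0.
Qed.

End MatrixSVD.

Section TensorOfMatrix.
Variable C : numClosedFieldType.
Local Open Scope sesquilinear_scope.

Definition unrsh M N (I : 'I_M -> nat) (J : 'I_N -> nat)
    (X : 'M[C]_(\prod_k I k, \prod_k J k)) : tensor C I J :=
  [ffun ij => X (lin ij.1) (lin ij.2)].

Lemma rshK M N (I : 'I_M -> nat) (J : 'I_N -> nat) (A : tensor C I J) :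
  unrsh (rsh A) = A.
Proof. by apply/ffunP => -[i j]; rewrite ffunE rshE. Qed.

Lemma unrsh_mul M N L (I : 'I_M -> nat) (J : 'I_N -> nat) (K : 'I_L -> nat)
    (X : 'M[C]_(\prod_k I k, \prod_k J k))
    (Y : 'M[C]_(\prod_k J k, \prod_k K k)) :
  unrsh (X *m Y) = einstein (unrsh X) (unrsh Y).
Proof.
apply/ffunP => -[i k]; rewrite !ffunE mxE /= (reindex (@lin _ J)) /=.
  by apply: eq_bigr => j _; rewrite !ffunE.
by exists (@unlin _ J) => ? _; rewrite ?linK ?unlinK.
Qed.

Lemma unrsh_conjtr M N (I : 'I_M -> nat) (J : 'I_N -> nat)
    (X : 'M[C]_(\prod_k I k, \prod_k J k)) :
  unrsh (X^t*) = conjtr (unrsh X).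
Proof. by apply/ffunP => -[j i]; rewrite !ffunE !mxE. Qed.

Lemma unrsh1 N (J : 'I_N -> nat) : unrsh 1%:M = idtensor C J.
Proof.
apply/ffunP => -[i j]; rewrite !ffunE mxE /= (can_eq (@linK _ J)).
have [<- | neij] := eqVneq i j; first by rewrite big1 // => k _; rewrite eqxx.
(* Distinct multi-indices differ in some component, whose factor kills the product of deltas. *)
have [k neijk] : exists k, i k != j k.
  apply/existsP; apply: contraNT neij => /existsPn eqij.
  by apply/eqP/ffunP => k; apply/eqP/negPn.
by rewrite (bigD1 k) //= (negPf neijk) mul0r.
Qed.

Lemma unrsh_unitary M (I : 'I_M -> nat) (X : 'M[C]_(\prod_k I k)) :
  X \is unitarymx -> unitary_tensor (unrsh X).
Proof.
move=> /unitarymxP XXt; split; rewrite -unrsh_conjtr -unrsh_mul -unrsh1.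
  by rewrite XXt.
by rewrite (mulmx1C XXt).
Qed.

End TensorOfMatrix.

Theorem lemma2 (R : realType) (M N : nat) (I : 'I_M -> nat) (J : 'I_N -> nat)
    (A : tensor R[i] I J) (r : nat) (hr : rshrank A = r) :
  exists (U : tensor R[i] I I) (V : tensor R[i] J J) (D : tensor R[i] I J)
         (sigma : nat -> R),
    [/\ A = einstein (einstein U D) (conjtr V),
        unitary_tensor U /\ unitary_tensor V,
        diagonal_tensor D,
        (forall (i : mindex I) (j : mindex J),
           D (i, j) = if (lindex i == lindex j) && (lindex i < r)%N
                      then (sigma (lindex i))%:C else 0)
      & forall p : nat, (p < r)%N -> 0 < sigma p].
Proof.
rewrite -{r}hr; have [P [Q [s [Pu Qu s_gt0 defA]]]] := svd (rsh A).
(* In the order of [R[i]], a positive number has zero imaginary part, so the singular values come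
   from [R]. *)
have sE k : s 0 k = (complex.Re (s 0 k))%:C /\ 0 < complex.Re (s 0 k).
  by move: (s_gt0 k); case: (s 0 k) => a b; rewrite ltcE /= => /andP[/eqP-> ->].
pose D : 'M_(\prod_k I k, \prod_k J k) :=
  pid_mx (\rank (rsh A)) *m diag_mx s *m pid_mx (\rank (rsh A)).
have DE i j : unrsh D (i, j) =
    if lindex i == lindex j then oapp (s 0) 0 (insub (lindex i)) else 0.
  by rewrite ffunE pid_diag_pidE.
exists (unrsh P), (unrsh Q), (unrsh D).
(* The singular values, indexed from 0 to [r - 1], are extended by 0 to all of [nat]. *)
exists (fun p => oapp (fun k => complex.Re (s 0 k)) 0 (insub p)); split.
- by rewrite -[LHS]rshK {1}defA !unrsh_mul unrsh_conjtr.
- by split; apply: unrsh_unitary.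
- by move=> i j /eqP/negPf neij; rewrite DE neij.
- move=> i j; rewrite DE /rshrank; case: eqP => //= _.
  by case: insubP => [k -> _ | /negPf ->] //=; case: (sE k).
- move=> p ltpr; rewrite insubT /=; exact: (sE _).2.
Qed.
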